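(* Let $\mathfrak{g}=\mathfrak{g}(A)$ be any BKM Lie algebra and $\lambda\in\mathfrak{h}^*$. Then $$\mathrm{wt}\,L(\lambda)=W_{I_{L(\lambda)}}\,\{\mu\preceq\lambda\mid \mu\text{ satisfies (i), (ii), (iii)}\},$$ where: (i) $\mu(\alpha_i^\vee)\in\mathbb{Z}_{\ge0}$ for all $i\in I_{L(\lambda)}$; (ii) for every connected component $J_t$ of $\mathrm{supp}(\lambda-\mu)$ with $J_t\subseteq J_\lambda$, there exists $j_t\in J_t$ with $\lambda(\alpha_{j_t}^\vee)\neq0$; (iii) for every connected component $J_t$ of $\mathrm{supp}(\lambda-\mu)$ with $J_t\subseteq J_\lambda$ consisting of a single node $j_t$, one has $j_t\in\mathcal{I}^+\sqcup\mathcal{I}^-$ and $\lambda-\big(\tfrac{2}{A_{j_tj_t}}\lambda(\alpha_{j_t}^\vee)+1\big)\alpha_{j_t}\not\succeq\mu$.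
   Context: BKM-Cartan matrix: a real matrix $A=(A_{ij})_{i,j\in\mathcal{I}}$, $\mathcal{I}$ finite, with $A_{ii}\in\{2\}\sqcup\mathbb{R}_{\le0}$; $A_{ij}=0\iff A_{ji}=0$; $A_{ij}\in\mathbb{R}_{\le 0}$ for $i\ne j$; and $A_{ij}\in\mathbb{Z}_{\le0}$ whenever $A_{ii}=2$, $j\neq i$. Put $\mathcal{I}^+=\{i: A_{ii}=2\}$, $\mathcal{I}^0=\{i:A_{ii}=0\}$, $\mathcal{I}^-=\{i:A_{ii}<0\}$. The BKM Lie algebra $\mathfrak{g}=\mathfrak{g}(A)$ over $\mathbb{C}$ has Cartan subalgebra $\mathfrak{h}$ ($\dim\mathfrak{h}=|\mathcal{I}|+\text{nullity}(A)$), linearly independent simple roots $\Pi=\{\alpha_i\}\subset\mathfrak{h}^*$ and simple co-roots $\{\alpha_i^\vee\}\subset\mathfrak{h}$ with $\alpha_j(\alpha_i^\vee)=A_{ij}$, and Chevalley generators $e_i,f_i$ ($i\in\mathcal I$), with the usual relations ($[h,e_i]=\alpha_i(h)e_i$, $[h,f_i]=-\alpha_i(h)f_i$, $[e_i,f_j]=\delta_{ij}\alpha_i^\vee$), the Serre relations $\mathrm{ad}_{e_i}^{1-A_{ij}}(e_j)=0=\mathrm{ad}_{f_i}^{1-A_{ij}}(f_j)$ for $i\in\mathcal{I}^+$, $j\ne i$, and $[e_i,e_j]=[f_i,f_j]=0$ when $A_{ij}=0$. The Weyl group $W$ is generated by the reflections $s_i$, $i\in\mathcal{I}^+$; for $K\subseteq\mathcal{I}^+$,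 $W_K=\langle s_i: i\in K\rangle$. The Dynkin graph has vertex set $\mathcal{I}$ with an edge between $i\ne j$ iff $A_{ij}\neq0$; connected components of a subset of $\mathcal I$ are those of the induced subgraph. For $x=\sum_i c_i\alpha_i$, $\mathrm{supp}(x)=\{i: c_i\ne0\}$. $\mu\preceq\lambda$ means $\lambda-\mu\in\mathbb{Z}_{\ge0}\Pi$. $L(\lambda)$ is the simple highest weight module of highest weight $\lambda$, and $\mathrm{wt}\,L(\lambda)$ its set of weights. $J_\lambda:=\{i\in\mathcal{I}: \lambda(\alpha_i^\vee)\in\frac{A_{ii}}{2}\mathbb{Z}_{\ge0}\}$ and $I_{L(\lambda)}:=J_\lambda\cap\mathcal{I}^+=\{i\in\mathcal I^+:\lambda(\alpha_i^\vee)\in\mathbb{Z}_{\ge0}\}$. *)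

(* Defs.v *)
From HB Require Import structures.
From mathcomp Require Import all_boot all_order all_algebra.
From mathcomp Require Import boolp classical_sets reals.
From mathcomp Require Import complex.

Set Implicit Arguments.
Unset Strict Implicit.
Unset Printing Implicit Defensive.

Import Order.TTheory GRing.Theory Num.Theory.
Local Open Scope ring_scope.
Local Open Scope quotient_scope.
Local Open Scope complex_scope.

HB.mixin Record isLieAlgebra (K : fieldType) G of GRing.Lmodule K G := {
  lie : G -> G -> G;
  lie_linearl : forall (a : K) (x y z : G),
    lie (a *: x + y) z = a *: lie x z + lie y z;
  lie_linearr : forall (a : K) (x y z : G),
    lie x (a *: y + z) = a *: lie x y + lie x z;
  liexx : forall x : G, lie x x = 0;
  lie_jacobi : forall x y z : G,
    lie x (lie y z) + lie y (lie z x) + lie z (lie x y) = 0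
}.

#[short(type="lieAlgType")]
HB.structure Definition LieAlgebra (K : fieldType) :=
  {G of GRing.Lmodule K G & isLieAlgebra K G}.

HB.mixin Record isLieModule (K : fieldType) (G : lieAlgType K) V
    of GRing.Lmodule K V := {
  lie_act : G -> V -> V;
  lie_act_linearl : forall (a : K) (x y : G) (v : V),
    lie_act (a *: x + y) v = a *: lie_act x v + lie_act y v;
  lie_act_linearr : forall (a : K) (x : G) (v w : V),
    lie_act x (a *: v + w) = a *: lie_act x v + lie_act x w;
  lie_act_lie : forall (x y : G) (v : V),
    lie_act (lie x y) v = lie_act x (lie_act y v) - lie_act y (lie_act x v)
}.

#[short(type="lieModType")]
HB.structure Definition LieModule (K : fieldType) (G : lieAlgType K) :=
  {V of GRing.Lmodule K V & isLieModule K G V}.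

Section Submodules.
Variables (K : fieldType) (G : lieAlgType K) (V : lieModType G).

Definition lie_submodule (W : set V) : Prop :=
  [/\ W 0, (forall (a : K) v w, W v -> W w -> W (a *: v + w))
    & (forall (x : G) v, W v -> W (lie_act x v))].

Definition lie_simple : Prop :=
  (exists v : V, v != 0) /\
  (forall W : set V, lie_submodule W -> W = [set 0]%classic \/ W = setT).

Definition lie_generates (v : V) : Prop :=
  forall W : set V, lie_submodule W -> W v -> W = setT.

End Submodules.

Section LieTerms.
Variables (K : fieldType) (X : Type).

Inductive lie_term : Type :=
| Tgen of X
| Tzero
| Tadd of lie_term & lie_term
| Tscale of K & lie_term
| Tlie of lie_term & lie_term.

Variable rel : lie_term -> Prop.

(* The least congruence making the terms a Lie algebra and killing [rel]. *)
Inductive lie_cong : lie_term -> lie_term -> Prop :=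
| cong_refl x : lie_cong x x
| cong_sym x y : lie_cong x y -> lie_cong y x
| cong_trans x y z : lie_cong x y -> lie_cong y z -> lie_cong x z
| cong_add x x' y y' :
    lie_cong x x' -> lie_cong y y' -> lie_cong (Tadd x y) (Tadd x' y')
| cong_scale a x x' : lie_cong x x' -> lie_cong (Tscale a x) (Tscale a x')
| cong_lie x x' y y' :
    lie_cong x x' -> lie_cong y y' -> lie_cong (Tlie x y) (Tlie x' y')
| cong_addA x y z : lie_cong (Tadd x (Tadd y z)) (Tadd (Tadd x y) z)
| cong_addC x y : lie_cong (Tadd x y) (Tadd y x)
| cong_add0 x : lie_cong (Tadd Tzero x) x
| cong_addN x : lie_cong (Tadd (Tscale (-1) x) x) Tzero
| cong_scaleA a b x : lie_cong (Tscale a (Tscale b x)) (Tscale (a * b) x)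
| cong_scale1 x : lie_cong (Tscale 1 x) x
| cong_scaleDr a x y :
    lie_cong (Tscale a (Tadd x y)) (Tadd (Tscale a x) (Tscale a y))
| cong_scaleDl x a b :
    lie_cong (Tscale (a + b) x) (Tadd (Tscale a x) (Tscale b x))
| cong_lie_linearl a x y z :
    lie_cong (Tlie (Tadd (Tscale a x) y) z)
             (Tadd (Tscale a (Tlie x z)) (Tlie y z))
| cong_lie_linearr a x y z :
    lie_cong (Tlie x (Tadd (Tscale a y) z))
             (Tadd (Tscale a (Tlie x y)) (Tlie x z))
| cong_liexx x : lie_cong (Tlie x x) Tzero
| cong_jacobi x y z :
    lie_cong (Tadd (Tadd (Tlie x (Tlie y z)) (Tlie y (Tlie z x)))
                   (Tlie z (Tlie x y))) Tzero
| cong_rel x : rel x -> lie_cong x Tzero.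

Definition lie_congb (x y : lie_term) : bool := `[< lie_cong x y >].

Lemma lie_congb_refl : reflexive lie_congb.
Proof. by move=> x; apply/asboolP/cong_refl. Qed.

Lemma lie_congb_sym : symmetric lie_congb.
Proof. by move=> x y; apply/asboolP/asboolP => /cong_sym. Qed.

Lemma lie_congb_trans : transitive lie_congb.
Proof.
by move=> y x z /asboolP xy /asboolP yz; apply/asboolP/(cong_trans xy).
Qed.

Canonical lie_cong_equiv :=
  EquivRel lie_congb lie_congb_refl lie_congb_sym lie_congb_trans.

End LieTerms.

Arguments Tgen {K X} _.
Arguments Tzero {K X}.

HB.instance Definition _ (K : fieldType) (X : Type) :=
  gen_eqMixin (lie_term K X).
HB.instance Definition _ (K : fieldType) (X : Type) :=
  gen_choiceMixin (lie_term K X).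

Definition lie_pres (K : fieldType) (X : Type) (rel : lie_term K X -> Prop) :=
  {eq_quot (lie_cong_equiv rel)}.

Section LiePresentation.
Variables (K : fieldType) (X : Type) (rel : lie_term K X -> Prop).
Local Notation term := (lie_term K X).
Local Notation G := (lie_pres rel).

HB.instance Definition _ := Choice.on G.
HB.instance Definition _ := EqQuotient.on G.

Definition pres_class (x : term) : G := \pi_G x.

Lemma pres_classP (x y : term) :
  lie_cong rel x y <-> pres_class x = pres_class y.
Proof.
by split=> [h|/eqmodP/asboolP //]; apply/eqmodP/asboolP.
Qed.

Lemma pres_reprK (x : G) : pres_class (repr x) = x.
Proof. exact: reprK. Qed.

Lemma pres_repr (x : term) : lie_cong rel (repr (pres_class x)) x.
Proof. by apply/pres_classP; rewrite pres_reprK. Qed.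

Definition pres_add (x y : G) : G := pres_class (Tadd (repr x) (repr y)).
Definition pres_scale (a : K) (x : G) : G := pres_class (Tscale a (repr x)).
Definition pres_lie (x y : G) : G := pres_class (Tlie (repr x) (repr y)).

Lemma pres_addE x y :
  pres_add (pres_class x) (pres_class y) = pres_class (Tadd x y).
Proof. by apply/pres_classP/cong_add; apply: pres_repr. Qed.

Lemma pres_scaleE a x :
  pres_scale a (pres_class x) = pres_class (Tscale a x).
Proof. by apply/pres_classP/cong_scale; apply: pres_repr. Qed.

Lemma pres_lieE x y :
  pres_lie (pres_class x) (pres_class y) = pres_class (Tlie x y).
Proof. by apply/pres_classP/cong_lie; apply: pres_repr. Qed.

Lemma pres_ind (P : G -> Prop) : (forall x, P (pres_class x)) -> forall x, P x.
Proof. by move=> h x; rewrite -(pres_reprK x). Qed.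

Let presE := (pres_addE, pres_scaleE, pres_lieE).

Let addA : associative pres_add.
Proof.
elim/pres_ind=> x; elim/pres_ind=> y; elim/pres_ind=> z.
by rewrite !presE; apply/pres_classP/cong_addA.
Qed.

Let addC : commutative pres_add.
Proof.
elim/pres_ind=> x; elim/pres_ind=> y.
by rewrite !presE; apply/pres_classP/cong_addC.
Qed.

Let add0 : left_id (pres_class Tzero) pres_add.
Proof.
by elim/pres_ind=> x; rewrite !presE; apply/pres_classP/cong_add0.
Qed.

Let addN : left_inverse (pres_class Tzero) (pres_scale (-1)) pres_add.
Proof.
by elim/pres_ind=> x; rewrite !presE; apply/pres_classP/cong_addN.
Qed.

HB.instance Definition _ := GRing.isZmodule.Build G addA addC add0 addN.

Let scaleA a b x : pres_scale a (pres_scale b x) = pres_scale (a * b) x.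
Proof.
by elim/pres_ind: x => x; rewrite !presE; apply/pres_classP/cong_scaleA.
Qed.

Let scale1 : left_id 1 pres_scale.
Proof.
by elim/pres_ind=> x; rewrite !presE; apply/pres_classP/cong_scale1.
Qed.

Let scaleDr : right_distributive pres_scale +%R.
Proof.
move=> a; elim/pres_ind=> x; elim/pres_ind=> y.
by rewrite /GRing.add/= !presE; apply/pres_classP/cong_scaleDr.
Qed.

Let scaleDl x : {morph pres_scale^~ x : a b / a + b}.
Proof.
move=> a b; elim/pres_ind: x => x.
by rewrite [RHS]/GRing.add/= !presE; apply/pres_classP/cong_scaleDl.
Qed.

HB.instance Definition _ :=
  GRing.Zmodule_isLmodule.Build K G scaleA scale1 scaleDr scaleDl.

Lemma pres_class0 : pres_class Tzero = 0. Proof. by []. Qed.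

Lemma pres_classD x y : pres_class (Tadd x y) = pres_class x + pres_class y.
Proof. by rewrite -pres_addE. Qed.

Lemma pres_classZ a x : pres_class (Tscale a x) = a *: pres_class x.
Proof. by rewrite -pres_scaleE. Qed.

Let lie_linearl a (x y z : G) :
  pres_lie (a *: x + y) z = a *: pres_lie x z + pres_lie y z.
Proof.
elim/pres_ind: x => x; elim/pres_ind: y => y; elim/pres_ind: z => z.
rewrite -pres_classZ -pres_classD !pres_lieE -pres_classZ -pres_classD.
exact/pres_classP/cong_lie_linearl.
Qed.

Let lie_linearr a (x y z : G) :
  pres_lie x (a *: y + z) = a *: pres_lie x y + pres_lie x z.
Proof.
elim/pres_ind: x => x; elim/pres_ind: y => y; elim/pres_ind: z => z.
rewrite -pres_classZ -pres_classD !pres_lieE -pres_classZ -pres_classD.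
exact/pres_classP/cong_lie_linearr.
Qed.

Let liexx (x : G) : pres_lie x x = 0.
Proof.
by elim/pres_ind: x => x; rewrite !presE; apply/pres_classP/cong_liexx.
Qed.

Let lie_jacobi (x y z : G) :
  pres_lie x (pres_lie y z) + pres_lie y (pres_lie z x)
  + pres_lie z (pres_lie x y) = 0.
Proof.
elim/pres_ind: x => x; elim/pres_ind: y => y; elim/pres_ind: z => z.
rewrite !pres_lieE -!pres_classD.
exact/pres_classP/cong_jacobi.
Qed.

HB.instance Definition _ :=
  isLieAlgebra.Build K G lie_linearl lie_linearr liexx lie_jacobi.

Lemma pres_class_lie x y :
  pres_class (Tlie x y) = lie (pres_class x) (pres_class y).
Proof. by rewrite -pres_lieE. Qed.

End LiePresentation.

Section CartanMatrix.
Variables (R : realType) (n : nat).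
Implicit Types A : 'M[R]_n.

Definition bkm_cartan A : Prop :=
  [/\ forall i, A i i = 2 \/ A i i <= 0,
      forall i j, A i j = 0 <-> A j i = 0,
      forall i j, i != j -> A i j <= 0
    & forall i j, A i i = 2 -> j != i -> exists k : nat, A i j = - k%:R].

Definition Iplus A : {set 'I_n} := [set i | A i i == 2].
Definition Izero A : {set 'I_n} := [set i | A i i == 0].
Definition Iminus A : {set 'I_n} := [set i | A i i < 0].

Definition dynkin A : rel 'I_n := [rel i j | (i != j) && (A i j != 0)].

Definition induced_dynkin A (S : {set 'I_n}) : rel 'I_n :=
  [rel i j | [&& i \in S, j \in S & dynkin A i j]].

Definition component A (S J : {set 'I_n}) : Prop :=
  exists2 i, i \in S & J = [set j in S | connect (induced_dynkin A S) i j].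

(* The minimal realization, unique up to isomorphism; [h^*] is ['Hom(h, C)].
   [n - \rank A] is the nullity of [A]. *)
Record realization A := Realization {
  cartan :> vectType R[i];
  roots : n.-tuple 'Hom(cartan, R[i]^o);
  coroots : n.-tuple cartan;
  dim_cartan : \dim {: cartan} = (n + (n - \rank A))%N;
  roots_free : free roots;
  coroots_free : free coroots;
  root_coroot : forall i j : 'I_n,
    tnth roots j (tnth coroots i) = (A i j)%:C
}.

End CartanMatrix.

Section BKM.
Variables (R : realType) (n : nat) (A : 'M[R]_n) (rl : realization A).
Local Notation C := R[i].

Definition dual : Type := 'Hom(rl, C^o).
HB.instance Definition _ := Vector.on dual.

Definition root (i : 'I_n) : dual := tnth (roots rl) i.
Definition coroot (i : 'I_n) : rl := tnth (coroots rl) i.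

Definition pairing (mu : dual) (h : rl) : C := (mu : 'Hom(rl, C^o)) h.

Inductive bkm_gen : Type := Ggenh of rl | Ggene of 'I_n | Ggenf of 'I_n.

Local Notation term := (lie_term C bkm_gen).
Local Notation th h := (@Tgen C bkm_gen (Ggenh h)).
Local Notation te i := (@Tgen C bkm_gen (Ggene i)).
Local Notation tf i := (@Tgen C bkm_gen (Ggenf i)).
Local Notation "x -t y" := (Tadd x (Tscale (-1) y)) (at level 50).

(* [rel_linear] makes the map from the Cartan subalgebra to [bkm] linear. *)
Inductive bkm_rel : term -> Prop :=
| rel_linear (a : C) (h h' : rl) :
    bkm_rel (th (a *: h + h') -t Tadd (Tscale a (th h)) (th h'))
| rel_hh (h h' : rl) : bkm_rel (Tlie (th h) (th h'))
| rel_he h i :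
    bkm_rel (Tlie (th h) (te i) -t Tscale (pairing (root i) h) (te i))
| rel_hf h i :
    bkm_rel (Tlie (th h) (tf i) -t Tscale (- pairing (root i) h) (tf i))
| rel_ef i j :
    bkm_rel (Tlie (te i) (tf j) -t Tscale (i == j)%:R (th (coroot i)))
| rel_serre_e i j (k : nat) : i \in Iplus A -> j != i -> A i j = - k%:R ->
    bkm_rel (iter k.+1 (Tlie (te i)) (te j))
| rel_serre_f i j (k : nat) : i \in Iplus A -> j != i -> A i j = - k%:R ->
    bkm_rel (iter k.+1 (Tlie (tf i)) (tf j))
| rel_ee0 i j : A i j = 0 -> bkm_rel (Tlie (te i) (te j))
| rel_ff0 i j : A i j = 0 -> bkm_rel (Tlie (tf i) (tf j)).

Definition bkm : lieAlgType C := lie_pres bkm_rel.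

Definition bkm_h (h : rl) : bkm := pres_class bkm_rel (Tgen (Ggenh h)).
Definition bkm_e (i : 'I_n) : bkm := pres_class bkm_rel (Tgen (Ggene i)).
Definition bkm_f (i : 'I_n) : bkm := pres_class bkm_rel (Tgen (Ggenf i)).

Section Modules.
Variable V : lieModType bkm.

Definition weight_vector (mu : dual) (v : V) : Prop :=
  forall h : rl, lie_act (bkm_h h) v = pairing mu h *: v.

Definition wt : set dual :=
  [set mu | exists2 v : V, v != 0 & weight_vector mu v]%classic.

(* Killed by every [e_i] is the same as killed by [n^+], which they generate. *)
Definition highest_weight_module (lam : dual) : Prop :=
  exists v : V,
    [/\ v != 0, weight_vector lam v, forall i, lie_act (bkm_e i) v = 0
      & lie_generates v].

Definition simple_highest_weight_module (lam : dual) : Prop :=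
  highest_weight_module lam /\ lie_simple V.

End Modules.

Definition reflection (i : 'I_n) (mu : dual) : dual :=
  mu - pairing mu (coroot i) *: root i.

Inductive weyl (S : {set 'I_n}) : (dual -> dual) -> Prop :=
| weyl_refl i : i \in S -> weyl S (reflection i)
| weyl_id : weyl S id
| weyl_comp w w' : weyl S w -> weyl S w' -> weyl S (w \o w')
| weyl_inv w w' : weyl S w -> cancel w w' -> cancel w' w -> weyl S w'.

Definition weyl_orbit (S : {set 'I_n}) (M : set dual) : set dual :=
  [set nu | exists w mu, [/\ weyl S w, M mu & nu = w mu]]%classic.

(* Meaningful for [x] in the span of the simple roots only. *)
Definition supp (x : dual) : {set 'I_n} :=
  [set i | coord (roots rl) i x != 0].

Definition preceq (mu lam : dual) : Prop :=
  exists c : 'I_n -> nat, lam - mu = \sum_i (c i)%:R *: root i.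

Definition Jset (lam : dual) : {set 'I_n} :=
  [set i | `[< exists k : nat,
                 pairing lam (coroot i) = (A i i / 2)%:C * k%:R >]].

Definition Iset (lam : dual) : {set 'I_n} := Jset lam :&: Iplus A.

Definition cond_i (lam mu : dual) : Prop :=
  forall i, i \in Iset lam -> exists k : nat, pairing mu (coroot i) = k%:R.

Definition cond_ii (lam mu : dual) : Prop :=
  forall J : {set 'I_n}, component A (supp (lam - mu)) J ->
    J \subset Jset lam -> exists2 j, j \in J & pairing lam (coroot j) != 0.

(* The first conjunct forces [A j j != 0], so [2 / A j j] is never [2 / 0]
   when the condition holds. *)
Definition cond_iii (lam mu : dual) : Prop :=
  forall (J : {set 'I_n}) (j : 'I_n), component A (supp (lam - mu)) J ->
    J \subset Jset lam -> J = [set j] ->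
    j \in Iplus A :|: Iminus A /\
    ~ preceq mu
        (lam - ((2 / A j j)%:C * pairing lam (coroot j) + 1) *: root j).

End BKM.

(* Main.v *)
Require Import Defs.
From HB Require Import structures.
From mathcomp Require Import all_boot all_order all_algebra.
From mathcomp Require Import boolp classical_sets reals.
From mathcomp Require Import complex.
From mathcomp Require Import ring zify.

(** Every weight of L is lam - beta with beta a nonnegative combination of
    simple roots, and a nonzero weight vector killed by all e_i has weight lam.
    Suppose f_i kills x <> 0 of weight lam - beta. Some word in
    the e_j carries x to a singular vector y, of weight lam; since f_i can only
    delete letters e_i of that word, f_i^(beta_i + 1) y = 0. The sl2 commutation
    rule, valid for real and imaginary i, then gives M, N <= beta_i with
    lam(alpha_i^vee) = M A_ii / 2 and (lam - beta)(alpha_i^vee) = - N A_ii / 2,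
    so (A beta)_i = (M + N) A_ii / 2.

    If mu = lam - alpha satisfies (i)-(iii), take a weight lam - beta with
    beta <= alpha that cannot be lowered further towards mu. Every i in the
    support of gamma = alpha - beta satisfies the above, and (A gamma)_i <= 0
    when i is real, by (i). A Perron-Frobenius type argument comparing beta and
    gamma on a component J of supp gamma shows that J is a component of
    supp alpha, and that either lam(alpha_i^vee) = 0 on J, against (ii), or
    J = {i} with beta_i = M, against (iii). Hence gamma = 0.

    Conversely, in a nonzero word in the f_j applied to the highest weight
    vector the letters of a component of the support can be applied first,
    which yields (ii) and (iii) for every weight; W-invariance and a height
    descent yield (i). *)

Set Implicit Arguments.
Unset Strict Implicit.
Unset Printing Implicit Defensive.

Import Order.TTheory GRing.Theory Num.Theory.
Local Open Scope ring_scope.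
Local Open Scope complex_scope.

Local Notation root := Defs.root.

HB.instance Definition _ (K : fieldType) (G : lieAlgType K)
    (V : lieModType G) (x : G) :=
  GRing.isLinear.Build K V V *:%R (lie_act x)
    (fun a v w => lie_act_linearr a x v w).

(** * Consequences of the Lie algebra axioms *)

Section LieAlgebra.
Variables (K : fieldType) (G : lieAlgType K).

Lemma lieNC (x y : G) : lie x y = - lie y x.
Proof.
have linl (a b c : G) : lie (a + b) c = lie a c + lie b c.
  by have := lie_linearl 1 a b c; rewrite !scale1r.
have linr (a b c : G) : lie a (b + c) = lie a b + lie a c.
  by have := lie_linearr 1 a b c; rewrite !scale1r.
apply/eqP; rewrite -addr_eq0; have := liexx (x + y).
by rewrite linl !linr !liexx add0r addr0 => ->.
Qed.

Lemma lieZr (a : K) (x y : G) :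
  lie x (a *: y) = a *: lie x y.
Proof.
have := lie_linearr 1 x 0 0; rewrite !scale1r addr0 => /eqP.
rewrite -subr_eq0 opprD addNKr oppr_eq0 => /eqP x0.
by have := lie_linearr a x y 0; rewrite x0 !addr0.
Qed.

Lemma lie_flip (a : K) (x y z : G) :
  lie x y = a *: z -> lie y x = - a *: z.
Proof. by move=> xy; rewrite lieNC xy scaleNr. Qed.

End LieAlgebra.

(** * Lie modules and nilpotent action of an element *)

Section LieModule.
Variables (K : fieldType) (G : lieAlgType K) (V : lieModType G).
Implicit Types (x y : G) (u v : V).

Lemma lie_actDl x y v : lie_act (x + y) v = lie_act x v + lie_act y v.
Proof. by have := lie_act_linearl 1 x y v; rewrite !scale1r. Qed.

Lemma lie_act0l v : lie_act (0 : G) v = 0.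
Proof.
by have /eqP := lie_actDl 0 0 v; rewrite addr0 -subr_eq0 opprD addNKr oppr_eq0 => /eqP.
Qed.

Lemma lie_actZl (a : K) x v : lie_act (a *: x) v = a *: lie_act x v.
Proof. by have := lie_act_linearl a x 0 v; rewrite lie_act0l !addr0. Qed.

Lemma lie_swap x y v :
  lie_act x (lie_act y v) = lie_act (lie x y) v + lie_act y (lie_act x v).
Proof. by rewrite lie_act_lie subrK. Qed.

Definition nilpotent_at x v : Prop := exists m, iter m (lie_act x) v = 0.

Lemma iter_act0 x k : iter k (lie_act x) (0 : V) = 0.
Proof. by elim: k => //= k ->; rewrite linear0. Qed.

Lemma iter_actD x k u v : iter k (lie_act x) (u + v) =
  iter k (lie_act x) u + iter k (lie_act x) v.
Proof. by elim: k => //= k ->; rewrite linearD. Qed.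

Lemma iter_actZ x k (a : K) v :
  iter k (lie_act x) (a *: v) = a *: iter k (lie_act x) v.
Proof. by elim: k => //= k ->; rewrite linearZ. Qed.

Lemma iter_act_ge x v m k : (m <= k)%N -> iter m (lie_act x) v = 0 ->
  iter k (lie_act x) v = 0.
Proof. by move=> /subnK <-; rewrite iterD => ->; rewrite iter_act0. Qed.

Lemma nilpotent_at0 x : nilpotent_at x 0.
Proof. by exists 0. Qed.

Lemma nilpotent_atD x (a : K) u v :
  nilpotent_at x u -> nilpotent_at x v -> nilpotent_at x (a *: u + v).
Proof.
move=> [m um] [k vk]; exists (m + k)%N; rewrite iter_actD iter_actZ.
by rewrite (iter_act_ge (leq_addr _ _) um) (iter_act_ge (leq_addl _ _) vk) scaler0 addr0.
Qed.

(** By the Leibniz rule, [x^(k+m) (y v)] is a combination of terms [((ad x)^p y) (x^q v)] with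
    [p + q = k + m], so that [p >= k] or [q >= m]. The induction on [k + m] moves one [x] past [y]
    at a time. *)
Lemma nilpotent_at_act x y v k : iter k (lie x) y = 0 ->
  nilpotent_at x v -> nilpotent_at x (lie_act y v).
Proof.
move=> yk [m vm]; exists (k + m)%N; move: yk vm.
have [s] : {s | s = k + m}%N by exists (k + m)%N.
elim: s k m y v => [|s IH] [|k] [|m] z w //= skm zk wm.
- by rewrite zk lie_act0l.
- by rewrite zk lie_act0l -iterS iter_act0.
- by rewrite wm linear0 -iterS iter_act0.
rewrite -iterS iterSr lie_swap iter_actD.
have -> : iter (k + m.+1) (lie_act x) (lie_act (lie x z) w) = 0.
  by apply: IH; rewrite -?iterSr//; lia.
by rewrite addnS -addSn add0r; apply: IH; rewrite -?iterSr//; lia.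
Qed.

Lemma nilpotent_max x v : v != 0 -> nilpotent_at x v ->
  exists m, iter m (lie_act x) v != 0 /\ iter m.+1 (lie_act x) v = 0.
Proof.
move=> v0 [m vm]; have ex : exists k, iter k (lie_act x) v == 0 by exists m; apply/eqP.
case: (ex_minnP ex) => -[|k] /eqP vk kmin; first by move: vk v0 => /= ->; rewrite eqxx.
exists k; split=> //; apply/negP => /kmin; by rewrite ltnn.
Qed.

End LieModule.

(** * Action of the Chevalley generators on weight vectors *)

Section Generators.
Variables (R : realType) (n : nat) (A : 'M[R]_n) (rl : realization A).
Local Notation C := R[i].
Local Notation g := (bkm rl).
Implicit Types (h : rl) (i j : 'I_n) (mu nu : dual rl).

Lemma pres_class_sub (x y : lie_term C (bkm_gen rl)) :
  bkm_rel (Tadd x (Tscale (-1) y)) ->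
  pres_class (@bkm_rel _ _ _ rl) x = pres_class (@bkm_rel _ _ _ rl) y.
Proof.
move=> /(@cong_rel _ _ (@bkm_rel _ _ _ rl)) /pres_classP.
by rewrite pres_class0 pres_classD pres_classZ scaleN1r => /subr0_eq.
Qed.

Lemma bkm_he h i : lie (bkm_h h) (bkm_e rl i) = pairing (root rl i) h *: bkm_e rl i.
Proof.
by rewrite -pres_class_lie -pres_classZ; apply/pres_class_sub/rel_he.
Qed.

Lemma bkm_hf h i : lie (bkm_h h) (bkm_f rl i) = - pairing (root rl i) h *: bkm_f rl i.
Proof.
by rewrite -pres_class_lie -pres_classZ; apply/pres_class_sub/rel_hf.
Qed.

Lemma bkm_ef i j :
  lie (bkm_e rl i) (bkm_f rl j) = (i == j)%:R *: bkm_h (coroot rl i).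
Proof.
by rewrite -pres_class_lie -pres_classZ; apply/pres_class_sub/rel_ef.
Qed.

Lemma bkm_ff0 i j : A i j = 0 -> lie (bkm_f rl i) (bkm_f rl j) = 0.
Proof.
move=> Aij; rewrite -pres_class_lie -pres_class0.
exact/pres_classP/cong_rel/rel_ff0.
Qed.

Lemma bkm_serre_f i j k : i \in Iplus A -> j != i -> A i j = - k%:R ->
  iter k.+1 (lie (bkm_f rl i)) (bkm_f rl j) = 0.
Proof.
move=> Ii ji Aij.
have /(@cong_rel _ _ (@bkm_rel _ _ _ rl)) /pres_classP := @rel_serre_f _ _ _ rl _ _ _ Ii ji Aij.
rewrite pres_class0 => <-.
by elim: (k.+1) => //= m IH; rewrite pres_class_lie -IH.
Qed.

Lemma pairingD mu nu h : pairing (mu + nu) h = pairing mu h + pairing nu h.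
Proof. by rewrite /pairing add_lfunE. Qed.

Lemma pairingB mu nu h : pairing (mu - nu) h = pairing mu h - pairing nu h.
Proof. by rewrite pairingD /pairing opp_lfunE. Qed.

Lemma pairingZ a mu h : pairing (a *: mu) h = a * pairing mu h.
Proof. by rewrite /pairing scale_lfunE. Qed.

Lemma pairing_sum (F : 'I_n -> dual rl) h :
  pairing (\sum_i F i) h = \sum_i pairing (F i) h.
Proof. by rewrite /pairing sum_lfunE. Qed.

Lemma pairing_root i j : pairing (root rl j) (coroot rl i) = (A i j)%:C.
Proof. exact: root_coroot. Qed.

Variable V : lieModType g.
Local Notation H h := (@lie_act _ _ V (bkm_h h)).
Local Notation E i := (@lie_act _ _ V (bkm_e rl i)).
Local Notation F i := (@lie_act _ _ V (bkm_f rl i)).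
Implicit Types (v w : V).

Lemma weight_act_e mu i v :
  weight_vector mu v -> weight_vector (mu + root rl i) (E i v).
Proof.
move=> wv h; rewrite lie_swap wv bkm_he lie_actZl linearZ -scalerDl pairingD.
by rewrite addrC.
Qed.

Lemma weight_act_f mu i v :
  weight_vector mu v -> weight_vector (mu - root rl i) (F i v).
Proof.
move=> wv h; rewrite lie_swap wv bkm_hf lie_actZl linearZ -scalerDl pairingB.
by rewrite addrC.
Qed.

Lemma weight_iter_e mu i k v :
  weight_vector mu v -> weight_vector (mu + k%:R *: root rl i) (iter k (E i) v).
Proof.
move=> wv; elim: k => [|k IH] /=; first by rewrite scale0r addr0.
by rewrite -natr1 scalerDl scale1r addrA; apply: weight_act_e.
Qed.

Lemma weight_iter_f mu i k v :
  weight_vector mu v -> weight_vector (mu - k%:R *: root rl i) (iter k (F i) v).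
Proof.
move=> wv; elim: k => [|k IH] /=; first by rewrite scale0r subr0.
by rewrite -natr1 scalerDl scale1r opprD addrA; apply: weight_act_f.
Qed.

Lemma weight_comb mu a v w :
  weight_vector mu v -> weight_vector mu w -> weight_vector mu (a *: v + w).
Proof.
move=> wv ww h; rewrite linearP /= wv ww scalerDr !scalerA.
by rewrite mulrC.
Qed.

Lemma weight_act_h mu h v : weight_vector mu v -> weight_vector mu (H h v).
Proof.
by move=> wv h'; rewrite wv linearZ /= wv scalerA scalerA mulrC.
Qed.

Lemma act_ef i j v : E i (F j v) = (i == j)%:R *: H (coroot rl i) v + F j (E i v).
Proof. by rewrite lie_swap bkm_ef lie_actZl. Qed.

Lemma act_ff i j v : A i j = 0 -> F i (F j v) = F j (F i v).
Proof. by move=> Aij; rewrite lie_swap bkm_ff0// lie_act0l add0r. Qed.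

(* The scalar is that of the sl2 commutation rule, with [A i i] in place of 2:
   it is meaningful for real and imaginary [i] alike. *)
Lemma act_e_iter_f mu i k v : weight_vector mu v ->
  E i (iter k.+1 (F i) v) = iter k.+1 (F i) (E i v)
    + (k.+1%:R * (pairing mu (coroot rl i) - k%:R * (A i i / 2)%:C))
      *: iter k (F i) v.
Proof.
move=> wv; elim: k => [|k IH].
  by rewrite /= act_ef eqxx scale1r wv mul0r subr0 mul1r addrC.
rewrite iterS act_ef eqxx scale1r IH linearD linearZ.
rewrite (weight_iter_f i k.+1 wv) -!iterS addrCA -scalerDl.
congr (_ + _ *: _); rewrite pairingB pairingZ pairing_root.
rewrite rmorphM /= fmorphV rmorph_nat -[k.+2%:R]natr1 -[k.+1%:R]natr1.
by field.
Qed.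

Lemma act_f_iter_e mu i k v : weight_vector mu v ->
  F i (iter k.+1 (E i) v) = iter k.+1 (E i) (F i v)
    - (k.+1%:R * (pairing mu (coroot rl i) + k%:R * (A i i / 2)%:C))
      *: iter k (E i) v.
Proof.
have fe w : F i (E i w) = E i (F i w) - H (coroot rl i) w.
  by rewrite act_ef eqxx scale1r addrC addKr.
move=> wv; elim: k => [|k IH].
  by rewrite /= fe wv mul0r addr0 mul1r.
rewrite iterS fe IH linearB linearZ.
rewrite (weight_iter_e i k.+1 wv) -!iterS -addrA -opprD -scalerDl.
congr (_ - _ *: _); rewrite pairingD pairingZ pairing_root.
rewrite rmorphM /= fmorphV rmorph_nat -[k.+2%:R]natr1 -[k.+1%:R]natr1.
by field.
Qed.

(** Every element of [bkm rl] is the class of a term, and a bracket acts as a commutator, so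
    induction on terms reduces stability to the generators. *)
Lemma submodule_gen (W : set V) : W 0 ->
  (forall a v w, W v -> W w -> W (a *: v + w)) ->
  (forall h v, W v -> W (H h v)) -> (forall i v, W v -> W (E i v)) ->
  (forall i v, W v -> W (F i v)) -> lie_submodule W.
Proof.
move=> W0 WP WH WE WF; split=> //.
have WD v w : W v -> W w -> W (v + w) by move/(WP 1)=> h /h; rewrite scale1r.
have WZ a v : W v -> W (a *: v) by move=> Wv; rewrite -[X in W X]addr0; apply: WP.
elim/pres_ind; elim=> [[h|i|i]||x IHx y IHy|a x IHx|x IHx y IHy] v Wv.
- exact: WH.
- exact: WE.
- exact: WF.
- by rewrite pres_class0 lie_act0l.
- by rewrite pres_classD lie_actDl; apply: WD; [apply: IHx|apply: IHy].
- by rewrite pres_classZ lie_actZl; apply/WZ/IHx.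
rewrite pres_class_lie lie_act_lie -scaleN1r.
by apply: WD; [apply/IHx/IHy|apply/WZ/IHy/IHx].
Qed.

(** Induction on the number of summands. If [h] separates the weight [mu] of the first summand from
    [nu], the operator [h - mu(h)] kills that summand, keeps the weights of the others, and
    multiplies the whole sum by [nu(h) - mu(h)], which is nonzero. *)
Lemma weight_sum_eq0 nu (s : seq V) :
  (forall x, x \in s -> exists2 mu, mu != nu & weight_vector mu x) ->
  weight_vector nu (\sum_(x <- s) x) -> \sum_(x <- s) x = 0.
Proof.
elim: {s}(size s) {-2}s (erefl (size s)) => [|m IH] [|x s] //= ss Hs.
  by rewrite big_nil.
rewrite big_cons => wsum.
have [mu munu wx] := Hs x (mem_head _ _).
have [h hmunu] : exists h, pairing mu h != pairing nu h.
  apply: contrapT => /forallNP eqmunu; case/eqP: munu; apply/lfunP => h.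
  exact/eqP/negPn/negP/eqmunu.
pose T y : V := H h y - pairing mu h *: y.
have Tsum : \sum_(y <- map T s) y = H h (\sum_(y <- s) y) - pairing mu h *: \sum_(y <- s) y.
  by rewrite big_map sumrB scaler_sumr (linear_sum (lie_act (bkm_h h))).
have Tx : H h (x + \sum_(y <- s) y) - pairing mu h *: (x + \sum_(y <- s) y) = \sum_(y <- map T s) y.
  by rewrite Tsum linearD /= wx scalerDr opprD addrACA subrr add0r.
have key : \sum_(y <- map T s) y = (pairing nu h - pairing mu h) *: (x + \sum_(y <- s) y).
  by rewrite -Tx wsum scalerBl.
have /eqP : \sum_(y <- map T s) y = 0.
  apply: IH; first by rewrite size_map; case: ss.
    move=> _ /mapP[y ys ->]; have [rho ? wy] := Hs y (mem_behead (s := x :: s) ys).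
    exists rho => //; rewrite /T addrC -scaleNr.
    by apply: weight_comb => //; apply: weight_act_h.
  rewrite key -[X in weight_vector _ X]addr0.
  by apply: weight_comb => //; move=> h'; rewrite linear0 scaler0.
rewrite key scaler_eq0 subr_eq0 eq_sym (negPf hmunu) /= => /eqP //.
Qed.

End Generators.

(** * Weights below a given weight and their coordinates *)

Section Depth.
Variables (R : realType) (n : nat) (A : 'M[R]_n) (rl : realization A).
Implicit Types (mu : dual rl) (b c : 'I_n -> nat) (i j : 'I_n).

(** The simple roots are free, so the natural coordinates [b] are determined by the weight
    ([lower_inj]), and comparing weights becomes arithmetic on natural numbers. *)
Definition lower mu b : dual rl := mu - \sum_i (b i)%:R *: root rl i.

Lemma eq_lower mu b c : b =1 c -> lower mu b = lower mu c.
Proof. by move=> bc; rewrite /lower; under eq_bigr do rewrite bc. Qed.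

Lemma lower0 mu : lower mu (fun=> 0%N) = mu.
Proof. by rewrite /lower big1 ?subr0// => i _; rewrite scale0r. Qed.

Lemma lower_add mu b c : lower (lower mu b) c = lower mu (fun i => b i + c i)%N.
Proof.
rewrite /lower -addrA -opprD -big_split; congr (_ - _).
by apply: eq_bigr => i _; rewrite natrD scalerDl.
Qed.

Lemma lower_delta mu (k : nat) j :
  lower mu (fun i => k * (i == j))%N = mu - k%:R *: root rl j.
Proof.
rewrite /lower (bigD1 j)//= eqxx muln1 big1 ?addr0// => i /negPf ->.
by rewrite muln0 scale0r.
Qed.

Lemma lower1 mu j : lower mu (fun i => (i == j) : nat) = mu - root rl j.
Proof.
rewrite -[root rl j]scale1r -(lower_delta mu 1).
by apply: eq_lower => i; rewrite mul1n.
Qed.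

Lemma sum_delta (k : nat) j : (\sum_i k * (i == j) = k)%N.
Proof.
rewrite (bigD1 j)//= eqxx muln1 big1 ?addn0// => i /negPf ->.
by rewrite muln0.
Qed.

Lemma root_tnth i : root rl i = (Defs.roots rl)`_i.
Proof. by rewrite /Defs.root (tnth_nth 0). Qed.

Lemma coord_roots (a : 'I_n -> R[i]) j :
  coord (Defs.roots rl) j (\sum_i a i *: root rl i) = a j.
Proof.
under eq_bigr do rewrite root_tnth.
by apply: coord_sum_free; apply: Defs.roots_free.
Qed.

Lemma lower_inj mu b c : lower mu b = lower mu c -> b =1 c.
Proof.
move=> /addrI/oppr_inj eqs i.
have := congr1 (fun x : dual rl => coord (Defs.roots rl) i x) eqs.
by rewrite !coord_roots => /eqP; rewrite eqr_nat => /eqP.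
Qed.

Lemma lower_raise mu b c (k : nat) j :
  lower mu b + k%:R *: root rl j = lower mu c -> forall i, b i = (c i + k * (i == j))%N.
Proof.
move=> eqbc; apply: (@lower_inj mu).
by rewrite -lower_add lower_delta -eqbc addrK.
Qed.

Lemma pairing_lower mu b i : pairing (lower mu b) (coroot rl i) =
  pairing mu (coroot rl i) - (\sum_j A i j * (b j)%:R)%:C.
Proof.
rewrite /lower pairingB pairing_sum rmorph_sum /=; congr (_ - _).
by apply: eq_bigr => j _; rewrite pairingZ pairing_root rmorphM /= rmorph_nat mulrC.
Qed.

Lemma preceqP (mu nu : dual rl) :
  preceq mu nu <-> exists b, mu = lower nu b.
Proof.
split=> [[c eqc]|[b ->]]; first by exists c; rewrite /lower -eqc subKr.
by exists b; rewrite /lower subKr.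
Qed.

Lemma supp_lower mu b : supp (mu - lower mu b) = [set i | b i != 0%N].
Proof.
apply/setP => i; rewrite !inE /lower subKr coord_roots.
by rewrite pnatr_eq0.
Qed.

End Depth.

(** * Singular vectors, words in the generators, and the kernel of [f_i] *)

Section HighestWeight.
Variables (R : realType) (n : nat) (A : 'M[R]_n) (rl : realization A).
Variable V : lieModType (bkm rl).
Local Notation H h := (@lie_act _ _ V (bkm_h h)).
Local Notation E i := (@lie_act _ _ V (bkm_e rl i)).
Local Notation F i := (@lie_act _ _ V (bkm_f rl i)).
Implicit Types (v w x y : V) (mu nu : dual rl) (i j : 'I_n) (b c : 'I_n -> nat).
Implicit Types (s : seq 'I_n).

Definition f_word s v : V := foldr (fun i => F i) v s.
Definition e_word s v : V := foldr (fun i => E i) v s.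
Definition content s i : nat := count_mem i s.

Definition singular mu y : Prop :=
  [/\ y != 0, weight_vector mu y & forall i, E i y = 0].

Lemma weight_f_word mu y s : weight_vector mu y ->
  weight_vector (lower mu (content s)) (f_word s y).
Proof.
move=> wy; elim: s => [|j s IH] /=; first by rewrite lower0.
rewrite (_ : lower _ _ = lower mu (content s) - root rl j); first exact: weight_act_f.
by rewrite -lower1 lower_add; apply: eq_lower => i /=; rewrite addnC eq_sym.
Qed.

Lemma wtI mu y : y != 0 -> weight_vector mu y -> wt V mu.
Proof. by exists y. Qed.

Lemma weight_scale mu a y : weight_vector mu y -> weight_vector mu (a *: y).
Proof. by move=> wy h; rewrite linearZ /= wy !scalerA mulrC. Qed.

(** Moving [E i] through a word in the [F j] produces only Cartan elements, which act on words by
    scalars, until [E i] reaches [y] and kills it. *)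
Lemma f_span_submodule mu y : singular mu y ->
  lie_submodule [set x : V | exists2 S : seq V,
     (forall z, z \in S -> exists a s, z = a *: f_word s y)
     & x = \sum_(z <- S) z]%classic.
Proof.
move=> [_ wy ey]; set W := (X in lie_submodule X).
have W0 : W 0 by exists [::]; rewrite ?big_nil.
have WD v w : W v -> W w -> W (v + w).
  move=> [S HS ->] [T HT ->]; exists (S ++ T); rewrite ?big_cat//.
  by move=> z; rewrite mem_cat => /orP[/HS|/HT].
have WZ a v : W v -> W (a *: v).
  move=> [S HS ->]; exists (map (fun z => a *: z) S).
    by move=> _ /mapP[z /HS [b [s ->]] ->]; exists (a * b), s; rewrite scalerA.
  by rewrite big_map scaler_sumr.
have Wop (T : {linear V -> V}) : (forall s, W (T (f_word s y))) -> forall v, W v -> W (T v).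
  move=> WT _ [S HS ->]; rewrite linear_sum.
  elim: S HS => [|z S IH] HS; first by rewrite big_nil.
  rewrite big_cons; apply: WD; last by apply: IH => t tS; apply: HS; rewrite inE tS orbT.
  by have [a [s ->]] := HS z (mem_head _ _); rewrite linearZ; apply/WZ/WT.
have Wf s : W (f_word s y).
  exists [:: f_word s y]; last by rewrite big_seq1.
  by move=> z; rewrite inE => /eqP->; exists 1, s; rewrite scale1r.
have WH h v : W v -> W (H h v).
  by apply: (Wop (lie_act (bkm_h h))) => s /=; rewrite (weight_f_word s wy); apply: WZ.
have WF i v : W v -> W (F i v).
  by apply: (Wop (lie_act (bkm_f rl i))) => s; apply: (Wf (i :: s)).
apply: submodule_gen => //; first by move=> *; apply: WD => //; apply: WZ.
move=> i v; apply: (Wop (lie_act (bkm_e rl i))) => s; elim: s => [|j s IH] /=.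
  by rewrite ey.
by rewrite act_ef; apply: WD; [apply/WZ/WH|apply: WF].
Qed.

Hypothesis simpleV : lie_simple V.

(** By simplicity the words in the [F j] applied to [y] span [V]. If all words of weight [nu]
    vanished, a vector of weight [nu] would be a sum of vectors of other weights, hence zero by
    [weight_sum_eq0]. *)
Lemma weight_f_wordP mu y nu : singular mu y -> wt V nu ->
  exists2 s, f_word s y != 0 & nu = lower mu (content s).
Proof.
move=> sy [x x0 wx]; have [y0 wy _] := sy.
have [WE|WT] := simpleV.2 _ (f_span_submodule sy).
  have /=: [set 0 : V]%classic y.
    rewrite -WE; exists [:: y]; last by rewrite big_seq1.
    by move=> z; rewrite inE => /eqP ->; exists 1, [::]; rewrite scale1r.
  by move=> y0'; rewrite y0' eqxx in y0.
have : [set: V]%classic x by []; rewrite -WT => -[S HS xS].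
apply: contrapT => noword.
have xS' : x = \sum_(z <- filter (fun z => z != 0) S) z.
  by rewrite big_filter xS (bigID (fun z => z != 0)) /= [X in _ + X]big1 ?addr0// => z /negPn/eqP.
case/negP: x0; rewrite xS'; apply/eqP/weight_sum_eq0; last by rewrite -xS'; exact: wx.
move=> z; rewrite mem_filter => /andP[z0 /HS[a [s zE]]].
exists (lower mu (content s)); last by rewrite zE; apply/weight_scale/weight_f_word.
apply/eqP => muE; apply: noword; exists s => //; apply/eqP => fs0.
by move: z0; rewrite zE fs0 scaler0 eqxx.
Qed.

Lemma wt_lower mu y nu : singular mu y -> wt V nu -> exists b, nu = lower mu b.
Proof. by move=> sy /(weight_f_wordP sy) [s _ ->]; exists (content s). Qed.

Lemma singular_wt mu y : singular mu y -> wt V mu.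
Proof. by case=> y0 wy _; apply: wtI wy. Qed.

(** Each of the two weights lies below the other. *)
Lemma singular_weight mu nu y z : singular mu y -> singular nu z -> mu = nu.
Proof.
move=> sy sz.
have [b muE] := wt_lower sz (singular_wt sy).
have [c nuE] := wt_lower sy (singular_wt sz).
have b0 : b =1 fun=> 0%N.
  move=> i; have := muE; rewrite nuE lower_add -{1}[mu]lower0 => /lower_inj/(_ i).
  by move=> /eqP; rewrite eq_sym addn_eq0 => /andP[_ /eqP].
by rewrite muE (eq_lower _ b0) lower0.
Qed.

Variables (lam : dual rl) (v0 : V).
Hypothesis sv : singular lam v0.

(** Induction on the height of [b]: unless [x] is singular, some [E j] raises it to a nonzero vector
    of smaller height. The final singular vector has weight [lam], which fixes the letters used. *)
Lemma e_word_singular b x : x != 0 -> weight_vector (lower lam b) x ->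
  exists2 s, content s =1 b & singular lam (e_word s x).
Proof.
have [m] : {m | m = \sum_i b i}%N by eexists.
elim: m b x => [|m IH] b x mE x0 wx;
    (have [ex|/existsNP[j /eqP ejx]] := pselect (forall i, E i x = 0);
    [have bE := singular_weight (And3 x0 wx ex) sv;
     have b0 : b =1 fun=> 0%N by apply: (@lower_inj _ _ _ _ lam); rewrite bE lower0
    |have we : weight_vector (lower lam b + root rl j) (E j x) by apply: weight_act_e]);
    try by [exists [::] => [i|]; [rewrite b0|split=> //; rewrite -bE]].
- have [c] := wt_lower sv (wtI ejx we).
  rewrite -[root rl j]scale1r => /(@lower_raise _ _ _ _ _ _ _ 1)/(_ j).
  by move/eqP: mE; rewrite eq_sym sum_nat_eq0 => /forallP/(_ j)/eqP ->; rewrite eqxx muln1 addn1.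
have [c cE] := wt_lower sv (wtI ejx we).
have bE : forall i, b i = (c i + 1 * (i == j))%N.
  by apply: (@lower_raise _ _ _ _ lam); rewrite scale1r.
have [||s sE ss] := IH c (E j x) _ ejx.
- apply/eqP; rewrite -eqSS mE; under eq_bigr do rewrite bE.
  by rewrite big_split /= sum_delta addn1.
- by rewrite -cE.
(* [E j] is applied first, hence is the last letter of the word. *)
exists (rcons s j); last by rewrite /e_word -cats1 foldr_cat.
by move=> i; rewrite /content -cats1 count_cat -/(content s i) sE bE /= addn0 mul1n eq_sym.
Qed.

Lemma weight_e_word mu y s : weight_vector mu y ->
  exists nu, weight_vector nu (e_word s y).
Proof.
move=> wy; elim: s => [|j s [nu IH]] /=; first by exists mu.
by exists (nu + root rl j); apply: weight_act_e.
Qed.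

(* [F i] commutes with [E j] for [j != i], and moving it past [E i] only
   deletes that letter: after [content s i] deletions it reaches [x]. *)
Lemma iter_f_e_word mu x i s k : weight_vector mu x -> F i x = 0 ->
  (content s i < k)%N -> iter k (F i) (e_word s x) = 0.
Proof.
move=> wx fx; elim: s k => [|j s IH] [|k] //= sk; first by rewrite -iterS iterSr fx iter_act0.
have [nu ws] := weight_e_word s wx.
have [ji|ji] := eqVneq j i; last first.
  move: sk; rewrite /content /= (negPf ji) add0n => sk.
  have fe z : F i (E j z) = E j (F i z) by rewrite act_ef (negPf ji) scale0r add0r.
  suff -> m : iter m (F i) (E j (e_word s x)) = E j (iter m (F i) (e_word s x)).
    by rewrite fe -iterS IH// linear0.
  by elim: m => //= m ->; rewrite fe.
subst j; move: sk; rewrite /content /= eqxx add1n ltnS => sk.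
rewrite -iterS; have := act_e_iter_f i k ws.
rewrite (IH k.+1); last exact: ltnW.
by rewrite (IH k)// linear0 scaler0 addr0 => <-.
Qed.

(** A nonzero [e_i^k x] has a weight below [lam], which bounds [k] by [b i]. *)
Lemma iter_e_max b x i : x != 0 -> weight_vector (lower lam b) x ->
  exists2 N, (N <= b i)%N & iter N (E i) x != 0 /\ iter N.+1 (E i) x = 0.
Proof.
move=> x0 wx.
have bound k : iter k (E i) x != 0 -> (k <= b i)%N.
  move=> ek; have [c] := wt_lower sv (wtI ek (weight_iter_e i k wx)).
  by move=> /lower_raise/(_ i) ->; rewrite eqxx muln1 leq_addl.
have [|N [eN eN1]] := @nilpotent_max _ _ V (bkm_e rl i) x x0.
  exists (b i).+1; apply/eqP/negPn/negP => /bound; by rewrite ltnn.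
by exists N => //; apply: bound.
Qed.

(** [M] is the last power of [f_i] not killing the singular vector [y] above [x], and [N] the last
    power of [e_i] not killing [x]. Applying [e_i] to [f_i^(M+1) y = 0] and [f_i] to
    [e_i^(N+1) x = 0] forces the scalars of the commutation rules to vanish. *)
Lemma f_kernel_weight b x i : x != 0 -> weight_vector (lower lam b) x ->
  F i x = 0 -> exists M N : nat, [/\ (M <= b i)%N, (N <= b i)%N,
    pairing lam (coroot rl i) = M%:R * (A i i / 2)%:C
    & pairing (lower lam b) (coroot rl i) = - (N%:R * (A i i / 2)%:C)].
Proof.
move=> x0 wx fx.
have [s sb [y0 wy ey]] := e_word_singular x0 wx.
have [|M [fM fM1]] := @nilpotent_max _ _ V (bkm_f rl i) _ y0.
  by exists (b i).+1; rewrite (iter_f_e_word wx fx)// sb.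
have [N Nb [eN eN1]] := iter_e_max i x0 wx.
exists M, N; split=> //.
- rewrite leqNgt; apply/negP => bM; move/negP: fM; apply.
  by rewrite (iter_f_e_word wx fx)// sb.
- have := act_e_iter_f i M wy; rewrite fM1 ey linear0 iter_act0 add0r => /esym/eqP.
  by rewrite scaler_eq0 (negPf fM) orbF mulf_eq0 pnatr_eq0 /= subr_eq0 => /eqP.
have := act_f_iter_e i N wx; rewrite eN1 fx linear0 iter_act0 sub0r => /esym/eqP.
by rewrite oppr_eq0 scaler_eq0 (negPf eN) orbF mulf_eq0 pnatr_eq0 /= addr_eq0 => /eqP.
Qed.

End HighestWeight.

(** * A Perron-Frobenius type argument on the Cartan matrix *)

Section Balance.
Variables (R : realType) (n : nat) (A : 'M[R]_n).
Hypothesis hA : bkm_cartan A.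
Implicit Types (i j k : 'I_n).

Lemma connect_stable (T : finType) (e : rel T) (Z : {set T}) x :
  x \in Z -> (forall y z, y \in Z -> e y z -> z \in Z) ->
  forall y, connect e x y -> y \in Z.
Proof.
move=> xZ stab y /connectP[p pth ->] {y}.
by elim: p x xZ pth => //= z p IH x xZ /andP[/(stab _ _ xZ)/IH].
Qed.

Lemma induced_dynkin_sym (S : {set 'I_n}) : symmetric (induced_dynkin A S).
Proof.
case: hA => _ sym _ _ i j; rewrite /induced_dynkin /dynkin /= andbCA (eq_sym i).
suff -> : (A i j == 0) = (A j i == 0) by [].
by apply/eqP/eqP => /sym.
Qed.

(** Paths in [T] remain paths in [S]. Conversely a path in [S] cannot leave [J]: a node of [S]
    adjacent to [J] lies in [T], hence in [J]. *)
Lemma component_widen (S T J : {set 'I_n}) : component A T J -> T \subset S ->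
  (forall i k, i \in J -> k \notin T -> A i k != 0 -> k \notin S) ->
  component A S J.
Proof.
move=> [t tT JE] TS out; exists t; first exact: (fintype.subsetP TS).
have tJ : t \in J by rewrite JE inE tT connect0.
apply/setP => j; apply/idP/idP; rewrite inE.
  rewrite JE inE => /andP[jT tj]; rewrite (fintype.subsetP TS _ jT) /=.
  apply: connect_sub tj => x y /and3P[xT yT xy]; apply: connect1.
  by apply/and3P; split=> //; apply: (fintype.subsetP TS).
move=> /andP[jS]; apply: connect_stable => // x y xJ /and3P[xS yS xy].
have yT : y \in T.
  by apply/negPn/negP => yT; case/andP: xy => _ /(out _ _ xJ yT); rewrite yS.
move: xJ; rewrite JE !inE yT => /andP[xT tx] /=.
by apply: connect_trans tx (connect1 _); apply/and3P.
Qed.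

Lemma nsumr_eq0 (f : 'I_n -> R) : (forall i, f i <= 0) -> 0 <= \sum_i f i ->
  forall i, f i = 0.
Proof.
move=> f0 sf i; apply/eqP; rewrite -oppr_eq0.
have /eqP : \sum_i - f i = 0.
  by apply/eqP; rewrite eq_le sumr_ge0 ?andbT 1?sumrN ?oppr_le0// => j _; rewrite oppr_ge0.
rewrite psumr_eq0; last by move=> j _; rewrite oppr_ge0.
by move=> /allP/(_ i); rewrite mem_index_enum => /(_ isT).
Qed.

(** Numerical form of a weight [lam - b] that cannot be lowered towards [lam - b - c]: [Mb], [Nb]
    and [Ab] come from [f_kernel_weight], and [Ac] from condition (i). *)
Variables (b c M N : 'I_n -> nat).
Hypothesis Mb : forall i, (0 < c i)%N -> (M i <= b i)%N.
Hypothesis Nb : forall i, (0 < c i)%N -> (N i <= b i)%N.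
Hypothesis Ab : forall i, (0 < c i)%N ->
  \sum_j A i j * (b j)%:R = (M i + N i)%:R * (A i i / 2).
Hypothesis Ac : forall i, (0 < c i)%N -> A i i = 2 ->
  \sum_j A i j * (c j)%:R <= 0.

(* Subtracting the largest multiple [t * c] of [c] from [b] that keeps
   [w = b - t * c] nonnegative on a component [J] of the support of [c] makes
   [w] vanish somewhere on [J]. At real nodes [A w >= 0] while the off-diagonal
   entries are nonpositive, so a zero of [w] propagates to its neighbours. *)
Lemma balanced_component (i0 : 'I_n) : (0 < c i0)%N ->
  exists J : {set 'I_n},
  [/\ component A [set i | (b i + c i)%N != 0%N] J, J \subset [set i | (0 < c i)%N]
    & (forall i, i \in J -> M i = 0%N) \/
      (exists2 i, J = [set i] & A i i = 0 \/ M i = b i)].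
Proof.
case: hA => diag sym off _ c0.
set S := [set i | _ != _]; set T := [set i | (0 < c i)%N].
pose e := induced_dynkin A T.
have i0T : i0 \in T by rewrite inE.
pose J := [set j in T | connect e i0 j].
have compT : component A T J by exists i0.
have i0J : i0 \in J by rewrite inE i0T connect0.
have JT : J \subset T by apply/fintype.subsetP => i; rewrite inE => /andP[].
have cJ i : i \in J -> (0 < c i)%N by move/(fintype.subsetP JT); rewrite inE.
have JJ i j : i \in J -> j \in J -> connect e i j.
  rewrite !inE => /andP[_ ii] /andP[_ ij].
  by apply: connect_trans ij; rewrite (sym_connect_sym (induced_dynkin_sym T)).
have outT i k : i \in J -> k \notin J -> A i k != 0 -> k \notin T.
  move=> iJ kJ Aik; apply: contra kJ => kT; rewrite inE kT.
  have /andP[iT ii] : (i \in T) && connect e i0 i by move: iJ; rewrite inE.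
  have [<-|ik] := eqVneq i k; first by [].
  by apply: connect_trans ii (connect1 _); apply/and3P; split=> //; apply/andP.
have compS : (forall i k, i \in J -> k \notin J -> A i k != 0 -> b k = 0%N) ->
    component A S J.
  move=> b0; apply: component_widen compT _ _.
    by apply/fintype.subsetP => i; rewrite !inE; case: (c i) => //= m; rewrite addnS.
  move=> i k iJ kT Aik; have kJ : k \notin J by apply: contra kT; apply/fintype.subsetP.
  by move: kT; rewrite !inE (b0 i k)// negbK -eqn0Ngt.
pose r i : R := (b i)%:R / (c i)%:R.
have [m mJ rmin] : exists2 m, m \in J & forall j, j \in J -> r m <= r j.
  by case: (@arg_minP _ _ _ i0 (mem J) r i0J) => m; exists m.
pose t := r m; pose w i : R := (b i)%:R - t * (c i)%:R.
have t0 : 0 <= t by rewrite divr_ge0.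
have wm : w m = 0.
  by rewrite /w /t /r divfK ?subrr// pnatr_eq0 -lt0n; apply: cJ.
have wJ i : i \in J -> 0 <= w i.
  move=> iJ; rewrite subr_ge0 -ler_pdivlMr ?ltr0n ?cJ//; exact: rmin.
have wout i k : i \in J -> k \notin J -> A i k != 0 -> w k = (b k)%:R.
  move=> iJ kJ Aik; have := outT i k iJ kJ Aik.
  by rewrite inE -eqn0Ngt /w => /eqP ->; rewrite mulr0 subr0.
have wA i k : i \in J -> A i k != 0 -> 0 <= w k.
  by move=> iJ Aik; have [/wJ//|kJ] := boolP (k \in J); rewrite (wout i).
(* At a zero [i] of [w] the diagonal term of [(A w)_i] vanishes and the other terms are nonpositive,
   while [(A w)_i >= M i]; so [M i] and all terms vanish. The lower bound comes from
   [b i = M i = N i = 0] when [t = 0], and from [Ab] and [Ac] when [i] is real. *)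
have prop i : i \in J -> w i = 0 -> t = 0 \/ A i i = 2 ->
    M i = 0%N /\ forall k, A i k != 0 -> w k = 0.
  move=> iJ wi ti.
  have sumw : (M i)%:R <= \sum_j A i j * w j.
    have -> : \sum_j A i j * w j = \sum_j A i j * (b j)%:R - t * \sum_j A i j * (c j)%:R.
      rewrite mulr_sumr -sumrB; apply: eq_bigr => j _; rewrite /w; ring.
    rewrite Ab ?cJ//; case: ti => [tz|Aii].
      have /eqP bi : b i == 0%N by rewrite -(pnatr_eq0 R) -wi /w tz mul0r subr0.
      have /eqP -> : M i == 0%N by rewrite -leqn0 -bi; apply/Mb/cJ.
      have /eqP -> : N i == 0%N by rewrite -leqn0 -bi; apply/Nb/cJ.
      by rewrite tz !mul0r subr0.
    have := Ac (cJ _ iJ) Aii; rewrite Aii divff ?pnatr_eq0// mulr1 natrD => Aci.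
    rewrite -addrA lerDl addr_ge0// oppr_ge0.
    by rewrite mulr_ge0_le0.
  have term k : A i k * w k <= 0.
    have [->|Aik] := eqVneq (A i k) 0; first by rewrite mul0r.
    have [<-|ik] := eqVneq i k; first by rewrite wi mulr0.
    by rewrite mulr_le0_ge0 ?off// (wA i).
  have sw0 : 0 <= \sum_j A i j * w j by apply: le_trans sumw.
  have terms := nsumr_eq0 term sw0; split.
    apply/eqP; rewrite -(pnatr_eq0 R) eq_le ler0n andbT.
    by move: sumw; rewrite big1.
  move=> k Aik; have /eqP := terms k.
  by rewrite mulf_eq0 (negPf Aik) => /eqP.
(* If [t = 0] or all of [J] is real, the zero of [w] at [m] spreads over the connected set [J] and
   to its neighbours outside, where [w = b]. *)
have [tr|] := pselect (t = 0 \/ forall i, i \in J -> A i i = 2).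
  have tr' i : i \in J -> t = 0 \/ A i i = 2 by case: tr => [|h /h]; [left|right].
  have wz i : i \in J -> w i = 0.
    move=> iJ; suff : i \in [set i in J | w i == 0] by rewrite inE => /andP[_ /eqP].
    apply: (connect_stable _ _ (JJ m i mJ iJ)); first by rewrite inE mJ wm eqxx.
    move=> x y /setIdP[xJ /eqP wx] xy; apply/setIdP.
    move: (xy) => /and3P[_ yT /andP[_ Axy]]; split.
      by move: xJ => /setIdP[_ ix]; apply/setIdP; split=> //; apply: connect_trans ix (connect1 xy).
    by rewrite ((prop x xJ wx (tr' x xJ)).2 y Axy).
  exists J; split=> //; last by left=> i iJ; case: (prop i iJ (wz i iJ) (tr' i iJ)).
  apply: compS => i k iJ kJ Aik; apply/eqP; rewrite -(pnatr_eq0 R) -(wout i)//.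
  by rewrite ((prop i iJ (wz i iJ) (tr' i iJ)).2 k Aik).
(* Otherwise [t > 0], so [b > 0] on [J], and [J] has an imaginary node [i]. As
   [(M i + N i) / 2 <= b i], row [i] of [Ab] makes the off-diagonal sum nonnegative, although its
   terms are nonpositive. Hence [b] vanishes at the neighbours of [i], none of which can lie in
   [J]. *)
move=> /not_orP[/eqP tn0 /existsNP[i /not_implyP[iJ Aii]]].
have {Aii}Aii : A i i <= 0 by case: (diag i).
have bJ j : j \in J -> b j != 0%N.
  move=> jJ; rewrite -lt0n -(ltr0n R); apply: lt_le_trans (_ : t * (c j)%:R <= _).
    by rewrite mulr_gt0 ?ltr0n ?cJ// lt0r tn0.
  by rewrite -subr_ge0; apply: wJ.
have MNb : ((M i + N i)%:R / 2 <= (b i)%:R :> R).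
  rewrite ler_pdivrMr// -natrM ler_nat muln2 -addnn.
  by apply: leq_add; [apply/Mb/cJ|apply/Nb/cJ].
have sum0 : \sum_(j | j != i) A i j * (b j)%:R = A i i * ((M i + N i)%:R / 2 - (b i)%:R).
  have := Ab (cJ _ iJ); rewrite (bigD1 i)//= => /(canRL (addKr _)) ->.
  by field.
have sum_ge0 : 0 <= \sum_(j | j != i) A i j * (b j)%:R.
  by rewrite sum0 mulr_le0// subr_le0.
have term j : (if j != i then A i j * (b j)%:R else 0) <= 0.
  by case: ifP => // ji; rewrite mulr_le0_ge0// off// eq_sym.
have terms j : j != i -> A i j != 0 -> b j = 0%N.
  move=> ji Aij; have := nsumr_eq0 term; rewrite -big_mkcond /= => /(_ sum_ge0 j)/eqP.
  by rewrite ji mulf_eq0 (negPf Aij) pnatr_eq0 => /eqP.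
have Ji : J = [set i].
  apply/setP => j; rewrite inE; apply/idP/eqP => [jJ|-> //].
  suff : j \in [set i] by rewrite inE => /eqP.
  apply: (connect_stable _ _ (JJ i j iJ jJ)); first by rewrite inE.
  move=> x y; rewrite !inE => /eqP -> /and3P[iT yT /andP[iy Aiy]].
  have yJ : y \in J.
    rewrite inE yT; move: iJ; rewrite inE => /andP[_ ii].
    by apply: connect_trans ii (connect1 _); apply/and3P; split=> //; apply/andP.
  have /bJ := yJ; rewrite (terms y)//; first by rewrite eq_sym.
exists J; split=> //.
  apply: compS => j k; rewrite {1}Ji inE => /eqP -> kJ Aik; apply: terms => //.
  by apply: contraNneq kJ => ->.
(* For [A i i != 0] the row now reads [M i + N i = 2 b i], and both summands are at most [b i]. *)
right; exists i => //; have [->|An0] := eqVneq (A i i) 0; [by left|right].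
have /esym/eqP : \sum_(j | j != i) A i j * (b j)%:R = 0.
  by rewrite big1// => j ji; have [->|/(terms _ ji) ->] := eqVneq (A i j) 0; rewrite ?mul0r ?mulr0.
rewrite sum0 eq_sym mulf_eq0 (negPf An0) subr_eq0 /= => /eqP MN.
have /eqP : ((M i + N i)%:R = (b i * 2)%:R :> R) by rewrite natrM -MN divfK ?pnatr_eq0.
rewrite eqr_nat => /eqP; have := Mb (cJ _ iJ); have := Nb (cJ _ iJ); lia.
Qed.

End Balance.

(** * Necessity of (ii) and (iii), and sufficiency of (i)-(iii) *)

Section SimpleWeights.
Variables (R : realType) (n : nat) (A : 'M[R]_n).
Hypothesis hA : bkm_cartan A.
Variables (rl : realization A) (V : lieModType (bkm rl)).
Hypothesis simpleV : lie_simple V.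
Variables (lam : dual rl) (v0 : V).
Hypothesis sv : singular lam v0.
Local Notation H h := (@lie_act _ _ V (bkm_h h)).
Local Notation E i := (@lie_act _ _ V (bkm_e rl i)).
Local Notation F i := (@lie_act _ _ V (bkm_f rl i)).
Implicit Types (v w x y : V) (mu nu : dual rl) (i j : 'I_n) (b c : 'I_n -> nat).
Implicit Types (s : seq 'I_n) (J : {set 'I_n}).

Let v0_neq0 : v0 != 0. Proof. by case: sv. Qed.
Let v0_weight : weight_vector lam v0. Proof. by case: sv. Qed.
Let v0_e i : E i v0 = 0. Proof. by case: sv => _ _; apply. Qed.

(** The scalar in [act_e_iter_f] vanishes, so a nonzero [f_i^(k+1) v0] would be singular of a weight
    other than [lam]. *)
Lemma iter_f_highest i (k : nat) :
  pairing lam (coroot rl i) = (A i i / 2)%:C * k%:R -> iter k.+1 (F i) v0 = 0.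
Proof.
move=> lami; apply/eqP/negPn/negP => fk.
have sk : singular (lower lam (fun j => k.+1 * (j == i))%N) (iter k.+1 (F i) v0).
  split=> //; first by rewrite lower_delta; apply: weight_iter_f.
  move=> j; have [->|ji] := eqVneq j i.
    rewrite (act_e_iter_f i k v0_weight) v0_e iter_act0 lami [k%:R * _]mulrC subrr.
    by rewrite mulr0 scale0r addr0.
  elim: (k.+1) => [|m IH] /=; first exact: v0_e.
  by rewrite act_ef (negPf ji) scale0r add0r IH linear0.
have := singular_weight simpleV sk sv; rewrite -{2}[lam]lower0 => /lower_inj/(_ i).
by rewrite eqxx muln1.
Qed.

Lemma f_highest i : pairing lam (coroot rl i) = 0 -> F i v0 = 0.
Proof. by move=> lami; apply: (@iter_f_highest i 0); rewrite lami mulr0. Qed.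

(** By [act_ff] the letters in [J] commute with the others, so they can be moved to the right, where
    they act first. *)
Lemma f_word_split J s x :
  {in s &, forall i j, i \in J -> j \notin J -> A i j = 0} ->
  f_word s x = f_word [seq i <- s | i \notin J] (f_word [seq i <- s | i \in J] x).
Proof.
elim: s => //= k s IH sJ; rewrite IH; last first.
  by move=> i j si sj; apply: sJ; rewrite inE ?si ?sj orbT.
case: (boolP (k \in J)) => kJ //=; set y := f_word _ x.
have : {in [seq i <- s | i \notin J], forall j, A k j = 0}.
  move=> j; rewrite mem_filter => /andP[jJ js].
  by apply: sJ; rewrite ?inE ?eqxx ?js ?orbT.
elim: [seq i <- s | i \notin J] => //= j t IHt tJ.
rewrite act_ff ?IHt// ?tJ ?mem_head// => i it; apply: tJ.
by rewrite inE it orbT.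
Qed.

Lemma component_separated (S J : {set 'I_n}) i j : component A S J ->
  i \in J -> j \in S -> j \notin J -> A i j = 0.
Proof.
move=> [t tS JE] iJ jS jJ; apply: contrapT => /eqP Aij; move/negP: jJ; apply.
have [<-//|ij] := eqVneq i j.
move: iJ; rewrite JE => /setIdP[iS ti]; apply/setIdP; split=> //.
by apply: connect_trans ti (connect1 _); apply/and3P; split=> //; apply/andP.
Qed.

Lemma f_word_component s J : f_word s v0 != 0 ->
  component A [set i | content s i != 0%N] J ->
  f_word [seq i <- s | i \in J] v0 != 0.
Proof.
move=> s0 cJ; apply: contra s0 => /eqP sJ0.
rewrite (@f_word_split J) ?sJ0.
  by elim: [seq _ <- s | _] => //= j t /eqP ->; rewrite linear0.
move=> i j si sj iJ jJ; apply: (component_separated cJ) => //.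
by rewrite inE /content -lt0n -has_count has_pred1.
Qed.

Lemma component_content s J : component A [set i | content s i != 0%N] J ->
  exists2 i, i \in J & i \in s.
Proof.
case=> t tS ->; exists t; first by apply/setIdP; rewrite connect0.
by move: tS; rewrite inE /content -lt0n -has_count has_pred1.
Qed.

(** The [J]-part of a nonzero word is nonempty and does not kill [v0]. Its last letter [j] acts
    first, and would kill [v0] if [lam(alpha_j^vee) = 0]. *)
Lemma wt_cond_ii mu : wt V mu -> cond_ii lam mu.
Proof.
move=> /(weight_f_wordP simpleV sv)[s s0 ->] J; rewrite supp_lower => cJ _.
have := f_word_component s0 cJ; have [i iJ si] := component_content cJ.
have : i \in [seq i <- s | i \in J] by rewrite mem_filter iJ.
have : {subset [seq i <- s | i \in J] <= J} by move=> j; rewrite mem_filter => /andP[].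
case/lastP: [seq i <- s | i \in J] => // t j tJ _ sj; exists j.
  by apply: tJ; rewrite mem_rcons mem_head.
apply: contra sj => /eqP lamj; rewrite /f_word -cats1 foldr_cat /= f_highest//.
by elim: t {tJ} => //= k t /eqP ->; rewrite linear0.
Qed.

(** For [J = {j}] the [J]-part of the word is a power of [f_j] not killing [v0]. If
    [lam(alpha_j^vee) = k A_jj / 2], the exponent is at most [k], whereas the excluded inequality
    would make it at least [k + 1]. *)
Lemma wt_cond_iii mu : wt V mu -> cond_iii lam mu.
Proof.
move=> wmu J j cJ JJ JE; have [j'] := wt_cond_ii wmu cJ JJ.
rewrite JE inE => /eqP -> lamj.
have : j \in Jset lam by apply: (fintype.subsetP JJ); rewrite JE inE.
rewrite inE => /asboolP[k lamk].
(* [A j j = 0] would give [lam(alpha_j^vee) = 0], against (ii). *)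
have Aj : A j j != 0.
  by apply: contra lamj; rewrite lamk => /eqP ->; rewrite mul0r rmorph0 mul0r.
split.
  rewrite !inE; have [diag _ _ _] := hA.
  by case: (diag j) => [->|]; rewrite ?eqxx// le_eqVlt (negPf Aj) /= => ->; rewrite orbT.
move: wmu cJ => /(weight_f_wordP simpleV sv)[s s0 ->]; rewrite supp_lower => cJ.
have := f_word_component s0 cJ; rewrite JE.
have -> : [seq i <- s | i \in [set j]] = nseq (content s j) j.
  elim: s {s0 cJ} => //= a s ->; rewrite inE.
  by have [->|] := eqVneq a j; rewrite /content /= ?eqxx ?add1n//= => /negPf ->.
have fE m : f_word (nseq m j) v0 = iter m (F j) v0 by elim: m => //= m ->.
rewrite fE.
move=> sj /preceqP[d]; have -> : (2 / A j j)%:C * pairing lam (coroot rl j) + 1 = k.+1%:R.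
  rewrite lamk mulrA -rmorphM /= mulrA divfK// divff ?pnatr_eq0//.
  by rewrite rmorph1 mul1r natr1.
rewrite -lower_delta lower_add => /lower_inj/(_ j); rewrite eqxx muln1 => sjE.
by case/eqP: sj; apply: iter_act_ge (iter_f_highest lamk); rewrite sjE leq_addr.
Qed.

(** If no step succeeds, every [f_i] with [c i > 0] kills [x], so [balanced_component] applies; each
    of its outcomes contradicts (ii) or (iii). *)
Lemma cond_step b c : wt V (lower lam b) ->
  cond_i lam (lower lam (fun i => b i + c i)%N) ->
  cond_ii lam (lower lam (fun i => b i + c i)%N) ->
  cond_iii lam (lower lam (fun i => b i + c i)%N) ->
  (exists i, (0 < c i)%N) ->
  exists2 j, (0 < c j)%N & wt V (lower lam (fun i => b i + (i == j))%N).
Proof.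
move=> [x x0 wx] ci cii ciii [i0 c0]; apply: contrapT => stuck.
have fx i : (0 < c i)%N -> F i x = 0.
  move=> ic; apply/eqP/negPn/negP => fi0; apply: stuck; exists i => //.
  by apply: (wtI fi0); rewrite -lower_add lower1; apply: weight_act_f.
have /choice[MN MNP] : forall i, exists MN : nat * nat, (0 < c i)%N ->
    [/\ (MN.1 <= b i)%N, (MN.2 <= b i)%N,
      pairing lam (coroot rl i) = MN.1%:R * (A i i / 2)%:C
    & pairing (lower lam b) (coroot rl i) = - (MN.2%:R * (A i i / 2)%:C)].
  move=> i; have [ic|_] := boolP (0 < c i)%N; last by exists (0, 0)%N.
  by have [M [N MN]] := f_kernel_weight simpleV sv x0 wx (fx i ic); exists (M, N).
pose M i := (MN i).1; pose N i := (MN i).2.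
have Mb i : (0 < c i)%N -> (M i <= b i)%N by case/MNP.
have Nb i : (0 < c i)%N -> (N i <= b i)%N by case/MNP.
have lamM i : (0 < c i)%N -> pairing lam (coroot rl i) = (A i i / 2)%:C * (M i)%:R.
  by case/MNP => _ _ -> _; rewrite mulrC.
have Ab i : (0 < c i)%N -> \sum_j A i j * (b j)%:R = (M i + N i)%:R * (A i i / 2).
  move=> /MNP[_ _ lami]; rewrite pairing_lower lami => /(canRL (subKr _)) sumE.
  by apply: (@complexI R); rewrite sumE [RHS]rmorphM /= rmorph_nat natrD mulrDl opprK.
(* Subtracting the pairings of [lam - b] and of the target gives [(A c)_i = - N i - k], where
   [k >= 0] is provided by (i). *)
have Ac i : (0 < c i)%N -> A i i = 2 -> \sum_j A i j * (c j)%:R <= 0.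
  move=> ic Aii; have iI : i \in Iset lam.
    by rewrite !inE Aii eqxx andbT; apply/asboolP; exists (M i); rewrite lamM// Aii.
  have [k] := ci i iI; rewrite -lower_add pairing_lower.
  have [_ _ _ ->] := MNP i ic; rewrite Aii divff ?pnatr_eq0// rmorph1 mulr1.
  move=> /(canRL (subKr _)) sumE; rewrite -(@lecR R) sumE.
  by rewrite subr_le0 (le_trans _ (ler0n _ _))// oppr_le0 ler0n.
have [J [cJ JT Jcase]] := balanced_component hA Mb Nb Ab Ac c0.
rewrite -(supp_lower lam) in cJ.
have Jc i : i \in J -> (0 < c i)%N by move=> /(fintype.subsetP JT); rewrite inE.
have JJ : J \subset Jset lam.
  apply/fintype.subsetP => i /Jc ic; rewrite inE; apply/asboolP; exists (M i).
  exact: lamM.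
have [j jJ /eqP lamj] := cii J cJ JJ.
case: Jcase => [M0|[i JE Mi]].
  by apply: lamj; rewrite lamM ?Jc// M0// mulr0.
have {jJ lamj} lami : pairing lam (coroot rl i) <> 0.
  by move: jJ lamj; rewrite JE inE => /eqP ->.
have iJ : i \in J by rewrite JE inE.
have Aii : A i i <> 0 by move=> A0; apply: lami; rewrite lamM ?Jc// A0 mul0r rmorph0 mul0r.
case: Mi => // Mi; have [_] := ciii J i cJ JJ JE; apply.
have -> : (2 / A i i)%:C * pairing lam (coroot rl i) + 1 = (b i).+1%:R.
  rewrite lamM ?Jc// mulrA -rmorphM /= mulrA divfK; last exact/eqP.
  by rewrite divff ?pnatr_eq0// rmorph1 mul1r natr1 Mi.
(* The target has depth [b i + c i >= b i + 1] at [i], so the truncated subtraction is exact. *)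
apply/preceqP; exists (fun j => b j + c j - (b i).+1 * (j == i))%N.
rewrite -lower_delta lower_add; apply: eq_lower => l.
have [->|_] := eqVneq l i; rewrite ?muln1 ?muln0 ?subn0// subnKC//.
by rewrite -addn1 leq_add2l Jc.
Qed.

(** Starting from [lam], [cond_step] descends one simple root at a time; the induction is on the
    height of the remaining difference [c]. *)
Lemma cond_wt mu : preceq mu lam -> cond_i lam mu -> cond_ii lam mu ->
  cond_iii lam mu -> wt V mu.
Proof.
move=> /preceqP[a ->] ci cii ciii.
suff descent (m : nat) b c : (forall i, a i = b i + c i)%N -> (\sum_i c i = m)%N ->
    wt V (lower lam b) -> wt V (lower lam a).
  apply: (descent _ (fun=> 0%N) a) => //; rewrite lower0.
  exact: singular_wt sv.
elim: m b c => [|m IH] b c aE csum wb.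
  rewrite (eq_lower _ (_ : a =1 b))// => i; rewrite aE.
  by move/eqP: csum; rewrite sum_nat_eq0 => /forallP/(_ i)/eqP ->; rewrite addn0.
have aL := eq_lower lam aE; rewrite aL in ci cii ciii.
have cpos : exists i, (0 < c i)%N.
  apply: contrapT => /forallNP c0; move: csum; rewrite big1// => i _.
  by apply/eqP; rewrite -leqn0 leqNgt; apply/negP/c0.
have [j cj wj] := cond_step wb ci cii ciii cpos.
apply: (IH _ (fun i => c i - 1 * (i == j))%N _ _ wj) => [i|].
  by rewrite aE mul1n; have [->|] := eqVneq i j; lia.
suff : (\sum_i (c i - 1 * (i == j)) + \sum_i 1 * (i == j) = m.+1)%N.
  by rewrite sum_delta addn1 => -[].
by rewrite -big_split -csum; apply: eq_bigr => i _ /=; have [->|] := eqVneq i j; lia.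
Qed.

(** * Weyl group invariance and reduction to dominant weights *)

Lemma Iset_pairing i : i \in Iset lam ->
  A i i = 2 /\ exists k : nat, pairing lam (coroot rl i) = (A i i / 2)%:C * k%:R.
Proof. by rewrite !inE => /andP[/asboolP ? /eqP]. Qed.

(** The vectors on which [f_i] is nilpotent contain [v0] and form a submodule, since [ad f_i] is
    nilpotent on the generators: [(ad f_i)^2] kills the Cartan elements, [(ad f_i)^3] the [e_j], and
    the Serre relations handle the [f_j] with [j != i]. *)
Lemma f_locally_nilpotent i x : i \in Iset lam -> nilpotent_at (bkm_f rl i) x.
Proof.
move=> iI; have [Aii [k lamk]] := Iset_pairing iI.
pose W := [set y : V | nilpotent_at (bkm_f rl i) y]%classic.
suff subW : lie_submodule W.
  have Wv : W v0 by exists k.+1; apply: iter_f_highest.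
  have [W0|WT] := simpleV.2 _ subW.
    by move: Wv; rewrite W0 => /= v00; case/eqP: v0_neq0.
  by have : [set: V]%classic x by []; rewrite -WT.
apply: submodule_gen => [|a y z|h y|j y|j y].
- exact: nilpotent_at0.
- exact: nilpotent_atD.
- apply: (@nilpotent_at_act _ _ _ _ _ _ 2) => /=.
  by rewrite (lie_flip (bkm_hf h i)) lieZr liexx scaler0.
- apply: (@nilpotent_at_act _ _ _ _ _ _ 3) => /=.
  by rewrite (lie_flip (bkm_ef rl j i)) lieZr (lie_flip (bkm_hf _ i)) !lieZr liexx !scaler0.
have [->|ji] := eqVneq j i.
  by apply: (@nilpotent_at_act _ _ _ _ _ _ 1) => /=; rewrite liexx.
have [_ _ _ /(_ i j Aii ji)[m Aij]] := hA.
by apply: (@nilpotent_at_act _ _ _ _ _ _ m.+1); apply: bkm_serre_f; rewrite ?inE ?Aii.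
Qed.

(** Applying [e_i] to [f_i^(r+1) y] gives [(r+1)(p-r) f_i^r y], with a nonzero scalar for
    [r < p]. *)
Lemma iter_f_neq0 mu i y (p r : nat) : A i i = 2 -> y != 0 -> weight_vector mu y ->
  E i y = 0 -> pairing mu (coroot rl i) = p%:R -> (r <= p)%N -> iter r (F i) y != 0.
Proof.
move=> Aii y0 wy ey mup; elim: r => [//|r IH] rp.
apply: contraNneq (IH (ltnW rp)) => fr0.
have := act_e_iter_f i r wy; rewrite fr0 linear0 ey iter_act0 add0r => /esym/eqP.
rewrite scaler_eq0 Aii divff ?pnatr_eq0// rmorph1 mulr1 mup mulf_eq0 pnatr_eq0 /=.
by rewrite subr_eq0 eqr_nat gtn_eqF.
Qed.

Lemma iter_e_neq0 mu i y (p r : nat) : A i i = 2 -> y != 0 -> weight_vector mu y ->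
  F i y = 0 -> pairing mu (coroot rl i) = - p%:R -> (r <= p)%N -> iter r (E i) y != 0.
Proof.
move=> Aii y0 wy fy mup; elim: r => [//|r IH] rp.
apply: contraNneq (IH (ltnW rp)) => er0.
have := act_f_iter_e i r wy; rewrite er0 linear0 fy iter_act0 sub0r => /esym/eqP.
rewrite oppr_eq0 scaler_eq0 Aii divff ?pnatr_eq0// rmorph1 mulr1 mup mulf_eq0 pnatr_eq0 /=.
by rewrite addrC subr_eq0 eqr_nat ltn_eqF.
Qed.

Lemma pairing_lower_int b i : i \in Iset lam ->
  exists z : int, pairing (lower lam b) (coroot rl i) = z%:~R.
Proof.
move=> /Iset_pairing[Aii [k lamk]].
have /choice[a aE] j : exists z : int, A i j = z%:~R.
  have [->|ji] := eqVneq j i; first by exists 2; rewrite Aii.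
  by have [_ _ _ /(_ i j Aii ji)[m ->]] := hA; exists (- m%:Z); rewrite rmorphN.
exists (k%:Z - \sum_j a j * (b j)%:Z).
rewrite pairing_lower lamk Aii divff ?pnatr_eq0// rmorph1 mul1r rmorphB /=.
congr (_ - _); rewrite !rmorph_sum; apply: eq_bigr => j _ /=.
by rewrite aE !rmorphM /= rmorph_int rmorph_nat.
Qed.

(** An sl2-string argument: go from [x] to one end of its string, then walk back past [x] to the
    mirror weight, the powers on the way being nonzero. *)
Lemma wt_reflection i mu : i \in Iset lam -> wt V mu -> wt V (reflection i mu).
Proof.
move=> iI wmu; have [Aii _] := Iset_pairing iI.
have [b muE] := wt_lower simpleV sv wmu.
have [z muz] : exists z : int, pairing mu (coroot rl i) = z%:~R.
  by rewrite muE; apply: pairing_lower_int.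
have [x x0 wx] := wmu; rewrite /reflection muz.
have rootii : pairing (root rl i) (coroot rl i) = 2.
  by rewrite pairing_root Aii rmorph_nat.
(* For a pairing [k >= 0], the top [e_i^N x] has pairing [k + 2N], and [k + N] steps down reach the
   reflected weight. *)
case: z muz => k muk.
  have wbx : weight_vector (lower lam b) x by rewrite -muE.
  have [N _ [eN eN1]] := iter_e_max simpleV sv i x0 wbx.
  have wN := weight_iter_e i N wx.
  have fN : iter (k + N) (F i) (iter N (E i) x) != 0.
    apply: (@iter_f_neq0 _ _ _ (k + N.*2) _ Aii eN wN); rewrite -?iterS //.
      by rewrite pairingD pairingZ rootii muk natrD -muln2 natrM.
    by rewrite leq_add2l -addnn leq_addr.
  apply: (wtI fN); rewrite -[k%:~R]pmulrn.
  rewrite (_ : mu - _ = mu + N%:R *: root rl i - (k + N)%:R *: root rl i).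
    exact: weight_iter_f.
  by rewrite natrD scalerDl opprD addrACA subrr addr0.
(* For a pairing [-(k+1)], the bottom [f_i^N x] exists by local nilpotency, and [k + 1 + N] steps up
   reach the reflected weight. *)
have [N [fN fN1]] := nilpotent_max x0 (f_locally_nilpotent x iI).
have wN := weight_iter_f i N wx.
have eN : iter (k.+1 + N) (E i) (iter N (F i) x) != 0.
  apply: (@iter_e_neq0 _ _ _ (k.+1 + N.*2) _ Aii fN wN); rewrite -?iterS //.
    by rewrite pairingB pairingZ rootii muk natrD -muln2 natrM opprD NegzE rmorphN.
  by rewrite leq_add2l -addnn leq_addr.
apply: (wtI eN); rewrite NegzE mulrNz scaleNr opprK -pmulrn.
rewrite (_ : mu + _ = mu - N%:R *: root rl i + (k.+1 + N)%:R *: root rl i).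
  exact: weight_iter_e.
by rewrite natrD scalerDl addrACA addNr addr0.
Qed.

Lemma reflectionK i : i \in Iset lam -> involutive (@reflection R n A rl i).
Proof.
move=> /Iset_pairing[Aii _] mu; rewrite /reflection pairingB pairingZ pairing_root Aii.
rewrite rmorph_nat -addrA -opprD -scalerDl.
set a := pairing mu _; have -> : a + (a - a * 2) = 0 by ring.
by rewrite scale0r subr0.
Qed.

(** The equivalence, rather than one implication, lets the induction pass through [weyl_inv]. *)
Lemma wt_weyl (w : dual rl -> dual rl) : weyl (Iset lam) w ->
  forall mu, wt V (w mu) <-> wt V mu.
Proof.
elim=> {w} [i iI|//|w w' _ IHw _ IHw'|w w' _ IHw ww' w'w] mu.
- by split=> [/(wt_reflection iI)|/(wt_reflection iI)//]; rewrite reflectionK.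
- by rewrite /= IHw.
by rewrite -IHw w'w.
Qed.

(** Induction on the height of [lam - mu]: if [mu(alpha_i^vee) = -(k+1)], reflecting adds
    [(k+1) alpha_i] to [mu] and so lowers that height. *)
Lemma wt_dominant mu : wt V mu -> exists (w : dual rl -> dual rl) nu,
  [/\ weyl (Iset lam) w, wt V nu, cond_i lam nu & mu = w nu].
Proof.
move=> wmu; have [b muE] := wt_lower simpleV sv wmu.
have [m] := ubnP (\sum_i b i); elim: m => // m IH in mu wmu b muE *; rewrite ltnS => bm.
have [dom|] := pselect (cond_i lam mu); first by exists id, mu; split=> //; apply: weyl_id.
move=> /existsNP[i /not_implyP[iI notnat]].
have [[k|k] muk] : exists z : int, pairing mu (coroot rl i) = z%:~R.
- by rewrite muE; apply: pairing_lower_int.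
- by case: notnat; exists k.
have wr := wt_reflection iI wmu; have [c rE] := wt_lower simpleV sv wr.
have bc := @lower_raise _ _ _ _ lam b c k.+1 i.
rewrite -muE -rE /reflection muk NegzE rmorphN scaleNr opprK in bc.
have {}bc := bc erefl.
have [|w [nu [Ww wnu dnu rnu]]] := IH _ wr c rE.
  apply: leq_trans bm; under [X in (_ < X)%N]eq_bigr do rewrite bc.
  by rewrite big_split /= sum_delta addnS ltnS leq_addr.
exists (reflection i \o w), nu; split=> //.
  by apply: weyl_comp => //; apply: weyl_refl.
by rewrite /= -rnu reflectionK.
Qed.

End SimpleWeights.

Theorem corollary3p4 (R : realType) (n : nat) (A : 'M[R]_n)
    (hA : bkm_cartan A) (rl : realization A) (lam : dual rl)
    (L : lieModType (bkm rl)) (hL : simple_highest_weight_module L lam) :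
  wt L = weyl_orbit (Iset lam)
    [set mu : dual rl |
       [/\ preceq mu lam, cond_i lam mu, cond_ii lam mu & cond_iii lam mu]]%classic.
Proof.
case: hL => -[v [v0 wv ev _]] simpleL; have sv : singular lam v by split.
apply/seteqP; split=> [mu /(wt_dominant hA simpleL sv)|_ [w [mu [Ww [le_mu mi mii miii] ->]]]].
  move=> [w [nu [Ww wnu dnu ->]]]; exists w, nu; split=> //; split=> //.
  - by apply/preceqP; exact: (wt_lower simpleL sv wnu).
  - exact: (wt_cond_ii simpleL sv wnu).
  exact: (wt_cond_iii hA simpleL sv wnu).
by apply/(wt_weyl hA simpleL sv Ww)/(cond_wt hA simpleL sv).
Qed.
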